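(* Let $\mathcal{M}\subseteq\mathbb{R}^n$ be a $k$-manifold and let $\mathbf{g}:\mathbb{R}^n\to\mathcal{M}$ be a continuously differentiable mapping (regarded as a map into $\mathbb{R}^n$). Then for every point $\mathbf{x}\in\mathbb{R}^n$ we have $\operatorname{rank} J_{\mathbf{g}}(\mathbf{x})\le k$.
   Context: $J_{\mathbf{g}}(\mathbf{x})=\left[\frac{\partial g_i}{\partial x_j}(\mathbf{x})\right]$ denotes the Jacobian matrix of $\mathbf{g}$ at $\mathbf{x}$. A subset $U\subseteq\mathbb{R}^n$ is said to be like $\mathbb{R}^k$ if there exist an open set $V\subseteq\mathbb{R}^k$ and an infinitely differentiable one-to-one mapping $\phi:V\to U$ (a bijection of $V$ onto $U$) whose inverse $\phi^{-1}:U\to V$ can be extended to an infinitely differentiable mapping $\psi:S\to\mathbb{R}^k$ on an open superset $S\supseteq U$ in $\mathbb{R}^n$, i.e. $\phi^{-1}(x)=\psi(x)$ for $x\in U$. A subset $\mathcal{M}\subseteq\mathbb{R}^n$ is called a $k$-dimensional manifold (or $k$-manifold) if every point $p\in\mathcal{M}$ has an open neighborhood $U\subseteq\mathbb{R}^n$ such that $U\cap\mathcal{M}$ is like $\mathbb{R}^k$. *)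

(* Defs.v *)
From HB Require Import structures.
From mathcomp Require Import all_boot all_order all_algebra.
From mathcomp Require Import all_classical all_reals all_analysis.
Import numFieldNormedType.Exports.

Set Implicit Arguments.
Unset Strict Implicit.
Unset Printing Implicit Defensive.

Local Open Scope classical_set_scope.
Local Open Scope ring_scope.

(* Points of R^n are row vectors.  A map defined only on an open set S is
   represented by a total function of which only the values on S matter: as S
   is open, continuity and derivatives at points of S do not depend on the
   values outside S. *)

Section Differentiability.
Context {R : realType}.

Definition has_partial n (f : 'rV[R]_n -> R) (j : 'I_n) (x : 'rV[R]_n) : Prop :=
  derivable f x (delta_mx 0 j).

Definition partial n (f : 'rV[R]_n -> R) (j : 'I_n) (x : 'rV[R]_n) : R :=
  'D_(delta_mx 0 j) f x.

Definition component n m (f : 'rV[R]_n -> 'rV[R]_m) (i : 'I_m) :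
    'rV[R]_n -> R :=
  fun x => f x 0 i.

(* Rows are indexed by the components of [f] and columns by the variables; the
   library's ['J f x], which acts on row vectors from the right, is the
   transpose of this matrix wherever [f] is differentiable. *)
Definition jacobian_matrix n m (f : 'rV[R]_n -> 'rV[R]_m) (x : 'rV[R]_n) :
    'M[R]_(m, n) :=
  \matrix_(i < m, j < n) partial (component f i) j x.

(* Class C^r on an open set S, for scalar functions: the iterated partial
   derivatives up to order r exist on S and those of order r are continuous
   there; continuity of those of lower order follows. *)
Fixpoint class_C (r : nat) n (S : set 'rV[R]_n) (f : 'rV[R]_n -> R) : Prop :=
  match r with
  | 0%N => forall x, S x -> {for x, continuous f}
  | r'.+1 => forall j : 'I_n,
      (forall x, S x -> has_partial f j x) /\ class_C r' S (partial f j)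
  end.

Definition continuously_differentiable_on n m (S : set 'rV[R]_n)
    (f : 'rV[R]_n -> 'rV[R]_m) : Prop :=
  forall i : 'I_m, class_C 1 S (component f i).

Definition infinitely_differentiable_on n m (S : set 'rV[R]_n)
    (f : 'rV[R]_n -> 'rV[R]_m) : Prop :=
  forall (i : 'I_m) (r : nat), class_C r S (component f i).

End Differentiability.

Section Manifolds.
Context {R : realType}.

Definition like_Rk (k n : nat) (U : set 'rV[R]_n) : Prop :=
  exists (V : set 'rV[R]_k) (phi : 'rV[R]_k -> 'rV[R]_n),
    [/\ open V, infinitely_differentiable_on V phi, set_bij V U phi
      & exists (S : set 'rV[R]_n) (psi : 'rV[R]_n -> 'rV[R]_k),
          [/\ open S, U `<=` S, infinitely_differentiable_on S psi
            & forall y, V y -> psi (phi y) = y]].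

Definition manifold (k n : nat) (M : set 'rV[R]_n) : Prop :=
  forall p, M p ->
    exists U : set 'rV[R]_n, [/\ open U, U p & like_Rk k (U `&` M)].

End Manifolds.

(* Main.v *)
(** A C^1 map is differentiable, by the mean value theorem applied to one
    coordinate at a time.  Near [x] the map [g] takes its values in a patch
    [phi @` V] of the manifold whose inverse chart extends to [psi], so that
    [g = phi \o (psi \o g)] near [x].  By the chain rule the differential of
    [g] at [x] factors through [R^k]. *)

Require Import Defs.
From HB Require Import structures.
From mathcomp Require Import all_boot all_order all_algebra.
From mathcomp Require Import all_classical all_reals all_analysis.
Import numFieldNormedType.Exports.
Import Order.TTheory GRing.Theory Num.Theory.

Set Implicit Arguments.
Unset Strict Implicit.
Unset Printing Implicit Defensive.

Local Open Scope classical_set_scope.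
Local Open Scope ring_scope.

Section C1_differentiable.
Context {R : realType}.

(** Both derivatives are limits of the same difference quotient. This lets the one-variable mean
    value theorem act on partial derivatives. *)
Lemma is_derive_line (V W : normedModType R) (f : V -> W) (q v : V) (t : R) :
  derivable f (t *: v + q) v ->
  is_derive t 1 (fun s : R => f (s *: v + q)) ('D_v f (t *: v + q)).
Proof.
have E : (fun h : R => h^-1 *: (((fun s : R => f (s *: v + q)) \o shift t) (h *: 1)
      - f (t *: v + q))) =
    (fun h => h^-1 *: ((f \o shift (t *: v + q)) (h *: v) - f (t *: v + q))).
  by apply/funext => h /=; rewrite [h *: 1]mulr1 scalerDl addrA.
by move=> dfv; split; rewrite /derivable /derive E.
Qed.

(** Mean value theorem between [0] and [s] for either sign of [s], as coordinate increments have no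
    preferred sign. *)
Lemma MVT0 (f df : R -> R) (s : R) :
  (forall t : R, `|t| <= `|s| -> is_derive t 1 f (df t)) ->
  exists2 c, `|c| <= `|s| & f s - f 0 = df c * s.
Proof.
move=> dfE.
have fcont (a b : R) : (forall t, t \in `[a, b] -> `|t| <= `|s|) ->
    {within `[a, b], continuous f}.
  move=> abs; apply: derivable_within_continuous => t /abs /dfE dft.
  exact: ex_derive.
have [s0|s0] := leP 0 s.
- have abs t : t \in `[0, s] -> `|t| <= `|s|.
    by rewrite in_itv /= => /andP[t0 ts]; rewrite !ger0_norm.
  have [|c /abs cs ->] := @MVT_segment _ f df _ _ s0 _ (fcont _ _ abs).
    by move=> t /subset_itv_oo_cc /abs /dfE.
  by exists c => //; rewrite subr0.
- have abs t : t \in `[s, 0] -> `|t| <= `|s|.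
    by rewrite in_itv /= => /andP[st t0]; rewrite !ler0_norm ?lerN2// ltW.
  have [|c /abs cs E] := @MVT_segment _ f df _ _ (ltW s0) _ (fcont _ _ abs).
    by move=> t /subset_itv_oo_cc /abs /dfE.
  by exists c => //; rewrite -[LHS]opprB E sub0r mulrN opprK.
Qed.

Lemma ler_mx_norm_entries (m n : nat) (A B : 'M[R]_(m, n)) :
  (forall i j, `|A i j| <= `|B i j|) -> `|A| <= `|B|.
Proof.
move=> AB; rewrite [leLHS]/Num.Def.normr [leRHS]/Num.Def.normr /= !mx_normrE.
by apply: le_bigmax2 => -[i j] _ /=.
Qed.

Lemma ler_entry_mx_norm (m n : nat) (A : 'M[R]_(m, n)) i j : `|A i j| <= `|A|.
Proof.
rewrite [leRHS]/Num.Def.normr /= mx_normrE.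
exact: (le_bigmax _ (fun ij => `|A ij.1 ij.2|) (i, j)).
Qed.

(** These are the vertices of a path from [0] to [h] along which one coordinate changes at a
    time. *)
Definition prefix n (h : 'rV[R]_n) (m : nat) : 'rV[R]_n :=
  \row_j if (j < m)%N then h 0 j else 0.

Lemma prefixS n (h : 'rV[R]_n) (j : 'I_n) :
  prefix h j.+1 = h 0 j *: delta_mx 0 j + prefix h j.
Proof.
apply/rowP => i; rewrite !mxE eqxx /= ltnS leq_eqVlt.
have [/val_inj ->|ij] := eqVneq (i : nat) j.
  by rewrite eqxx mulr1 ltnn addr0.
by rewrite (_ : (i == j) = false) ?mulr0 ?add0r //; apply: contraNF ij => /eqP->.
Qed.

(** The norm is the maximum of the entries, so the path never leaves a ball around [0] that contains
    [h]. *)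
Lemma ler_norm_prefix_step n (h : 'rV[R]_n) (j : 'I_n) (t : R) :
  `|t| <= `|h 0 j| -> `|t *: delta_mx 0 j + prefix h j| <= `|h|.
Proof.
move=> th; apply: ler_mx_norm_entries => i l; rewrite !mxE !ord1 eqxx /=.
have [->|lj] := eqVneq l j; first by rewrite ltnn mulr1 addr0.
by rewrite mulr0 add0r; case: ifP => // _; rewrite normr0.
Qed.

(** The increment telescopes along the path. Each step is a partial derivative at a nearby point
    times [h 0 j], and continuity moves that point to [p] at small cost. *)
Lemma class_C1_increment n (S : set 'rV[R]_n) (f : 'rV[R]_n -> R) p (e : R) :
  open S -> S p -> class_C 1 S f -> 0 < e ->
  \forall h \near nbhs (0 : 'rV[R]_n),
    `|f (h + p) - f p - \sum_j partial f j p * h 0 j| <= e * `|h|.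
Proof.
(* The [n] steps each cost at most [d * |h|], in total at most [e * |h|]; the successor keeps the
   denominator nonzero when [n] is [0]. *)
move=> oS Sp C1f e0; pose d := e / n.+1%:R.
have d0 : 0 < d by rewrite divr_gt0 ?ltr0n.
have : \forall q \near p,
    S q /\ forall j, `|partial f j p - partial f j q| <= d.
  apply: filterI; first exact: open_nbhs_nbhs.
  apply: (@filter_forall _ _ (fun j q => `|partial f j p - partial f j q| <= d) (nbhs p)) => j.
  have [_ /(_ p Sp) cf] := C1f j.
  by move/cvgrPdist_le : cf; apply.
move=> /nbhs_ballP[r r0 rP]; apply/nbhs_ballP; exists r => // h.
rewrite -ball_normE /= sub0r normrN => hr.
pose F m := f (prefix h m + p).
have hn : prefix h n = h by apply/rowP => j; rewrite mxE ltn_ord.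
have h0 : prefix h 0 = 0 by apply/rowP => j; rewrite !mxE.
have -> : f (h + p) - f p = \sum_(j < n) (F j.+1 - F j).
  by rewrite -(big_mkord xpredT (fun j => F j.+1 - F j)) telescope_sumr // /F
    hn h0 add0r.
rewrite -sumrB (le_trans (ler_norm_sum _ _ _))//.
have step (j : 'I_n) :
    `|F j.+1 - F j - partial f j p * h 0 j| <= d * `|h|.
  have near_p t : `|t| <= `|h 0 j| ->
      ball p r (t *: delta_mx 0 j + (prefix h j + p)).
    move=> /ler_norm_prefix_step /le_lt_trans /(_ hr).
    by rewrite -ball_normE /= addrA opprD addrCA subrr addr0 normrN.
  have [t|c ch] := @MVT0 (fun t => f (t *: delta_mx 0 j + (prefix h j + p)))
    (fun t => partial f j (t *: delta_mx 0 j + (prefix h j + p))) (h 0 j).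
    move=> /near_p /rP[St _]; apply: is_derive_line.
    by have [+ _] := C1f j; apply.
  rewrite scale0r add0r addrA -prefixS => E.
  rewrite /F E -mulrBl normrM ler_pM// ?ler_entry_mx_norm// distrC.
  by have [_] := rP _ (near_p _ ch); apply.
rewrite (le_trans (ler_sum _ (fun j _ => step j)))// sumr_const card_ord.
rewrite -mulrnAl ler_wpM2r// /d -mulr_natr -mulrA ler_piMr ?(ltW e0)//.
by rewrite mulrC ler_pdivrMr ?ltr0n// mul1r ler_nat.
Qed.

Lemma class_C1_differentiable n (S : set 'rV[R]_n) (f : 'rV[R]_n -> R) p :
  open S -> S p -> class_C 1 S f -> differentiable f p.
Proof.
move=> oS Sp C1f.
pose d (h : 'rV[R]_n) : R := \sum_j partial f j p * h 0 j.
have lin_d : linear d.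
  move=> a u v; rewrite /d scaler_sumr -big_split /=.
  by apply: eq_bigr => j _; rewrite !mxE mulrDr mulrCA.
pose dL : {linear 'rV[R]_n -> R} :=
  HB.pack d (GRing.isLinear.Build _ _ _ _ _ lin_d).
have cont_d : continuous dL.
  move=> h; apply: differentiable_continuous.
  have -> : (dL : 'rV[R]_n -> R) =
      \sum_j (partial f j p \*: (fun v : 'rV[R]_n => v 0 j)).
    by apply/funext => v; rewrite fct_sumE.
  by apply: differentiable_sum => j; apply: differentiableZ;
    exact: differentiable_coord.
have expand : (f : 'rV[R]_n -> R^o) \o shift p =
    cst (f p) + (dL : 'rV[R]_n -> R^o) +o_ (0 : 'rV[R]_n) id.
  apply/eqaddoP => e e0; have := class_C1_increment oS Sp C1f e0.
  by apply: filterS => h; rewrite opprD addrA.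
(* A continuous linear map with a first-order expansion is the differential, so [expand] becomes the
   criterion for differentiability. *)
by apply/diff_locallyP; rewrite (diff_unique cont_d expand).
Qed.

Lemma differentiable_row (V : normedModType R) n (f : V -> 'rV[R]_n) p :
  (forall i, differentiable (fun x => f x 0 i) p) -> differentiable f p.
Proof.
move=> df.
have -> : f = \sum_i (fun x => f x 0 i *: (delta_mx 0 i : 'rV[R]_n)).
  by apply/funext => x; rewrite fct_sumE [LHS]row_sum_delta.
by apply: differentiable_sum => i; exact: differentiableZl.
Qed.

Lemma continuously_differentiable_differentiable n m (S : set 'rV[R]_n)
    (f : 'rV[R]_n -> 'rV[R]_m) p :
  open S -> S p -> continuously_differentiable_on S f -> differentiable f p.
Proof.
move=> oS Sp C1f; apply: differentiable_row => i.
exact: class_C1_differentiable (C1f i).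
Qed.

Lemma jacobian_matrixE n m (f : 'rV[R]_n -> 'rV[R]_m) p :
  differentiable f p -> jacobian_matrix f p = (jacobian f p)^T.
Proof.
move=> df; apply/matrixP => i j.
rewrite !mxE -deriveE// derive_mx ?mxE//; exact: diff_derivable.
Qed.

(** Row [i] is the derivative along the [i]-th basis vector, so the chain rule is checked row by
    row. Row vectors put the inner map's factor on the left. *)
Lemma jacobian_comp n m l (f : 'rV[R]_n -> 'rV[R]_m) (g : 'rV[R]_m -> 'rV[R]_l)
    p : differentiable f p -> differentiable g (f p) ->
  jacobian (g \o f) p = jacobian f p *m jacobian g (f p).
Proof.
move=> df dg; apply/row_matrixP => i; rewrite !rowE mulmxA.
have dgf : differentiable (g \o f) p by exact: differentiable_comp.
rewrite -(deriveEjacobian _ dgf) -(deriveEjacobian _ df) -(deriveEjacobian _ dg).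
by rewrite (deriveE _ dgf) (deriveE _ df) (deriveE _ dg) diff_comp.
Qed.

Lemma near_eq_jacobian n m (f g : 'rV[R]_n -> 'rV[R]_m) p :
  differentiable f p -> differentiable g p ->
  (\forall q \near p, f q = g q) -> jacobian f p = jacobian g p.
Proof.
move=> df dg fg; apply/row_matrixP => i; rewrite [LHS]rowE [RHS]rowE.
apply: etrans (esym (deriveEjacobian _ df)) _.
by apply: etrans (deriveEjacobian _ dg); exact: near_eq_derive.
Qed.

End C1_differentiable.

Theorem theorem1 (R : realType) (k n : nat) (M : set 'rV[R]_n)
    (hM : manifold k M) (g : 'rV[R]_n -> 'rV[R]_n)
    (hgM : forall x : 'rV[R]_n, M (g x))
    (hg : continuously_differentiable_on [set: 'rV[R]_n] g)
    (x : 'rV[R]_n) :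
  (\rank (jacobian_matrix g x) <= k)%N.
Proof.
have dg : differentiable g x.
  exact: continuously_differentiable_differentiable openT _ hg.
have [U [oU Ugx [V [phi [oV Cphi [phiUM _ surj]]]]]] := hM _ (hgM x).
move=> [S [psi [oS US Cpsi psiK]]].
(* As [g z] always lies in [M], membership in [U] already puts it in the image of [phi]. *)
have phiK z : U (g z) -> V (psi (g z)) /\ phi (psi (g z)) = g z.
  by move=> Ugz; have [y Vy <-] := surj _ (conj Ugz (hgM z)); rewrite psiK.
have [Vy _] := phiK x Ugx.
have dpsi : differentiable psi (g x).
  apply: (continuously_differentiable_differentiable oS) => [|i].
    exact: US.
  exact: Cpsi.
have dphi : differentiable phi (psi (g x)).
  apply: (continuously_differentiable_differentiable oV Vy) => i.
  exact: Cphi.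
have dpsig : differentiable (psi \o g) x by exact: differentiable_comp.
have near_g : \forall z \near x, g z = (phi \o (psi \o g)) z.
  (* Continuity of [g] at [x] keeps nearby values in the open set [U]. *)
  have gU : \forall z \near x, U (g z).
    exact: (differentiable_continuous dg (open_nbhs_nbhs (conj oU Ugx))).
  by near=> z; have /phiK[_ /= ->] : U (g z) by near: z.
rewrite jacobian_matrixE// mxrank_tr.
rewrite (near_eq_jacobian dg (differentiable_comp dpsig dphi) near_g).
(* The factors have sizes [n] by [k] and [k] by [n], so the inner dimension [k] bounds the rank. *)
rewrite jacobian_comp//; exact: mulmx_max_rank.
Unshelve. all: by end_near.
Qed.
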